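(* For any two distinct quantum states $\rho_1$ and $\rho_2$ on $\mathbb{C}^d$ and any integer $n\ge 1$, the optimal $1\to n$ cloning cost satisfies $$\frac{\|\rho_1^{\otimes n}-\rho_2^{\otimes n}\|}{\|\rho_1-\rho_2\|}\;\le\;\eta_{1\to n}(\rho_1,\rho_2)\;\le\;\frac{4}{\|\rho_1-\rho_2\|}-1,$$ where $\|\cdot\|$ is the trace norm.
   Context: A quantum state on $\mathbb{C}^d$ is a positive semidefinite operator of trace $1$. The trace norm is $\|A\|=\operatorname{Tr}\sqrt{A^\dagger A}$. A CPTP map is a completely positive trace-preserving linear map. The optimal $1\to n$ cloning cost $\eta_{1\to n}(\rho_1,\rho_2)$ is the minimum of $\lambda_++\lambda_-$ over all real $\lambda_\pm\ge 0$ and CPTP maps $\Lambda_\pm$ from operators on $\mathbb{C}^d$ to operators on $(\mathbb{C}^d)^{\otimes n}$ such that the map $\tilde\Lambda=\lambda_+\Lambda_+-\lambda_-\Lambda_-$ is trace preserving (i.e. $\lambda_+-\lambda_-=1$) and satisfies $\tilde\Lambda(\rho_i)=\rho_i^{\otimes n}$ for $i=1,2$. *)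

(* Defs.v *)
From HB Require Import structures.
From mathcomp Require Import all_boot all_order all_algebra.
From mathcomp Require Import all_classical all_reals.
From mathcomp Require Export complex mxtens.

Set Implicit Arguments.
Unset Strict Implicit.
Unset Printing Implicit Defensive.

Import Order.TTheory GRing.Theory Num.Theory.
Local Open Scope ring_scope.
Local Open Scope sesquilinear_scope.
Local Open Scope complex_scope.

Section PositiveMatrices.
Variable C : numClosedFieldType.

Definition psdmx m (A : 'M[C]_m) : Prop :=
  A \is hermsymmx /\ forall u : 'cV[C]_m, 0 <= (u^t* *m A *m u) 0 0.

(* Only meaningful for normal [A]: the spectral decomposition
   [A = invmx P *m diag_mx s *m P] with [P] unitary then exists, and the
   square root is taken on the eigenvalues (see [sqrtmx_psd]). *)
Definition sqrtmx m (A : 'M[C]_m) : 'M[C]_m :=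
  invmx (spectralmx A) *m diag_mx (map_mx sqrtC (spectral_diag A))
    *m spectralmx A.

Lemma sqrtmx_psd m (A : 'M[C]_m) :
  psdmx A -> psdmx (sqrtmx A) /\ sqrtmx A *m sqrtmx A = A.
Proof.
move=> [Aherm Apos].
have /orthomx_spectralP A_eq := hermitian_normalmx Aherm.
rewrite /sqrtmx; set P := spectralmx A in A_eq *.
set s := spectral_diag A in A_eq *.
have PU : P \is unitarymx by exact: spectral_unitarymx.
have Pu : P \in unitmx by exact: spectral_unit.
have iP : invmx P = P^t* by exact: invmx_unitary.
have diagE (r : 'rV[C]_m) (u : 'cV[C]_m) :
    (u^t* *m (invmx P *m diag_mx r *m P) *m u) 0 0
      = \sum_i r 0 i * `|(P *m u) i 0| ^+ 2.
  have -> : u^t* *m (invmx P *m diag_mx r *m P) *m u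
      = (P *m u)^t* *m diag_mx r *m (P *m u).
    by rewrite trmx_mul map_mxM iP !mulmxA.
  rewrite mxE; apply: eq_bigr => i _.
  by rewrite mul_mx_diag !mxE normCKC mulrAC mulrA mulrC mulrA.
have s_ge0 i : 0 <= s 0 i.
  have := Apos (invmx P *m delta_mx i 0).
  rewrite A_eq diagE mulKVmx // (bigD1 i) //= big1 ?addr0 => [|j ji].
    by rewrite mxE !eqxx normr1 expr1n mulr1.
  by rewrite mxE (negPf ji) normr0 expr0n mulr0.
split; last first.
  rewrite !mulmxA mulmxK // -[X in X *m P]mulmxA mulmx_diag [RHS]A_eq.
  by do 3 f_equal; apply/rowP => i; rewrite !mxE -expr2 sqrtCK.
split=> [|u]; last first.
  rewrite diagE; apply: sumr_ge0 => i _.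
  by rewrite mulr_ge0 ?exprn_ge0 // mxE sqrtC_ge0.
set B := _ *m diag_mx _ *m P.
have rE : map_mx Num.conj (map_mx sqrtC s) = map_mx sqrtC s.
  by apply/rowP => i; rewrite !mxE conj_Creal // ger0_real // sqrtC_ge0.
apply/is_hermitianmxP; rewrite expr0 scale1r /B iP.
by rewrite !trmx_mul !map_mxM tr_diag_mx map_diag_mx rE trmxCK mulmxA.
Qed.

Definition quantum_state d (rho : 'M[C]_d) : Prop :=
  psdmx rho /\ \tr rho = 1.

(* The block [X_ij] in [X = \sum_(i, j) delta_mx i j *t X_ij]. *)
Definition tensblock k p (X : 'M[C]_(k * p)) (i j : 'I_k) : 'M[C]_p :=
  \matrix_(a, b) X (mxtens_index (i, a)) (mxtens_index (j, b)).

(* The map [id_k (x) f] (see [idtens_tensmx]). *)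
Definition idtens k p q (f : 'M[C]_p -> 'M[C]_q) (X : 'M[C]_(k * p)) :
    'M[C]_(k * q) :=
  \sum_i \sum_j delta_mx i j *t f (tensblock X i j).

Lemma idtens_tensmx k p q (f : {linear 'M[C]_p -> 'M[C]_q})
    (A : 'M[C]_k) (B : 'M[C]_p) :
  idtens f (A *t B) = A *t f B.
Proof.
rewrite /idtens.
have bE i j : tensblock (A *t B) i j = A i j *: B.
  by apply/matrixP => a b; rewrite !mxE !mxtens_indexK.
under eq_bigr => i _ do under eq_bigr => j _ do rewrite bE linearZ.
apply/matrixP => x y; rewrite summxE !mxE.
set i := (mxtens_unindex x).1; set j := (mxtens_unindex y).1.
rewrite (bigD1 i) //= summxE (bigD1 j) //= !big1 ?addr0.
- by rewrite !mxE !eqxx mul1r.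
- move=> i' ne; rewrite summxE big1 // => j' _.
  by rewrite !mxE -/i eq_sym (negPf ne) mul0r.
- by move=> j' ne; rewrite !mxE -/j [j == _]eq_sym (negPf ne) andbF mul0r.
Qed.

Definition completely_positive p q (f : {linear 'M[C]_p -> 'M[C]_q}) : Prop :=
  forall k (X : 'M[C]_(k * p)), psdmx X -> psdmx (idtens f X).

Definition trace_preserving p q (f : 'M[C]_p -> 'M[C]_q) : Prop :=
  forall X, \tr (f X) = \tr X.

Definition cptp p q (f : {linear 'M[C]_p -> 'M[C]_q}) : Prop :=
  completely_positive f /\ trace_preserving f.

End PositiveMatrices.

Section CloningCost.
Variable R : realType.

(* The trace of a positive semidefinite matrix is a nonnegative real, so
   taking [Re] only moves it from [R[i]] to [R]. *)
Definition trace_norm m (A : 'M[R[i]]_m) : R :=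
  complex.Re (\tr (sqrtmx (A^t* *m A))).

Definition quasi_map p q (lp lm : R) (Lp Lm : 'M[R[i]]_p -> 'M[R[i]]_q)
    (X : 'M[R[i]]_p) : 'M[R[i]]_q :=
  lp%:C *: Lp X - lm%:C *: Lm X.

Definition cloning_costs d n (rho1 rho2 : 'M[R[i]]_d) : set R :=
  [set c | exists (lp lm : R) (Lp Lm : {linear 'M[R[i]]_d -> 'M[R[i]]_(d ^ n)}),
    [/\ 0 <= lp /\ 0 <= lm, cptp Lp /\ cptp Lm,
        trace_preserving (quasi_map lp lm Lp Lm),
        quasi_map lp lm Lp Lm rho1 = ntensmx rho1 n
          /\ quasi_map lp lm Lp Lm rho2 = ntensmx rho2 n
      & c = lp + lm]].

Definition is_optimal_cloning_cost d n (rho1 rho2 : 'M[R[i]]_d) (eta : R) :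
    Prop :=
  cloning_costs n rho1 rho2 eta /\
  forall c, cloning_costs n rho1 rho2 c -> eta <= c.

End CloningCost.

(* Main.v *)
Require Import Defs.
From HB Require Import structures.
From mathcomp Require Import all_boot all_order all_algebra.
From mathcomp Require Import all_classical all_reals.
From mathcomp Require Import topology normedtype derive.
From mathcomp Require Import ring lra.
Import Order.TTheory GRing.Theory Num.Theory.
Import numFieldNormedType.Exports.
Set Implicit Arguments.
Unset Strict Implicit.
Unset Printing Implicit Defensive.
Local Open Scope ring_scope.

(* Lower bound: write [rho1 - rho2 = P - N] with [P, N] positive and
   [tr P + tr N] equal to the trace norm. The quasi-map sends [P - N] to
   [(lp Lp P + lm Lm N) - (lp Lp N + lm Lm P)], again a difference of positive
   matrices, whose traces sum to [(lp + lm) (tr P + tr N)].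

   Upper bound: let [tau1, tau2] be the target states, [M] the Helstrom
   projector, [a = tr (M rho1)] and [b = tr (M rho2)]. Then [D = a - b] is half
   the trace norm, and the quasi-map
     [X |-> tr ((M - b) X) / D *: tau1 + tr ((a - M) X) / D *: tau2]
   maps [rho1] to [tau1] and [rho2] to [tau2]. Its positive part is
   [1/D] times "measure [M] and prepare [tau1] or [tau2]", its negative part is
   [(1 - D)/D] times the preparation of a fixed mixture of [tau1] and [tau2], so
   its cost is [2/D - 1].

   Attainment: the entries of the matrix of a CPTP map are entries of its Choi
   matrix, hence bounded by 1, so the feasible quasi-maps with bounded [lp] form
   a compact set. *)

(** * Positive semidefinite matrices, tensor powers of states, and spectra *)

Section PsdTheory.
Local Open Scope sesquilinear_scope.
Variable C : numClosedFieldType.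

Lemma trmxC_mul m n p (A : 'M[C]_(m, n)) (B : 'M[C]_(n, p)) :
  (A *m B)^t* = B^t* *m A^t*.
Proof. by rewrite trmx_mul map_mxM. Qed.

Lemma trmxC_tens m n p q (A : 'M[C]_(m, n)) (B : 'M[C]_(p, q)) :
  (A *t B)^t* = A^t* *t B^t*.
Proof. by rewrite trmx_tens map_mxT. Qed.

Lemma hermsymmxP m (A : 'M[C]_m) : reflect (A^t* = A) (A \is hermsymmx).
Proof.
by apply: (iffP (is_hermitianmxP _ _ _)); rewrite expr0 scale1r => /esym.
Qed.

Lemma psdmx_gram m n (S : 'M[C]_(m, n)) : psdmx (S^t* *m S).
Proof.
split=> [|u]; first by apply/hermsymmxP; rewrite trmxC_mul trmxCK.
rewrite !mulmxA -trmxC_mul -mulmxA mxE sumr_ge0 // => i _.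
by rewrite !mxE mulrC mul_conjC_ge0.
Qed.

(** The positive square root is Hermitian, hence its own adjoint. With [psdmx_gram], this turns the
    closure properties below into rewriting of Gram matrices. *)
Lemma psdmx_factor m (A : 'M[C]_m) :
  psdmx A -> exists S : 'M[C]_m, A = S^t* *m S.
Proof.
by move=> /sqrtmx_psd[[/hermsymmxP Sh _] SS]; exists (sqrtmx A); rewrite Sh SS.
Qed.

Lemma psdmx0 m : psdmx (0 : 'M[C]_m).
Proof. by have := psdmx_gram (0 : 'M[C]_m); rewrite mulmx0. Qed.

Lemma psdmxD m (A B : 'M[C]_m) : psdmx A -> psdmx B -> psdmx (A + B).
Proof.
move=> [/hermsymmxP Ah A0] [/hermsymmxP Bh B0]; split=> [|u].
  by apply/hermsymmxP; rewrite linearD map_mxD Ah Bh.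
by rewrite mulmxDr mulmxDl mxE addr_ge0.
Qed.

Lemma psdmx_sum m I (r : seq I) (P : pred I) (A : I -> 'M[C]_m) :
  (forall i, P i -> psdmx (A i)) -> psdmx (\sum_(i <- r | P i) A i).
Proof. by move=> A0; elim/big_ind: _ => //; [exact: psdmx0|exact: psdmxD]. Qed.

Lemma psdmxZ m (a : C) (A : 'M[C]_m) : 0 <= a -> psdmx A -> psdmx (a *: A).
Proof.
move=> a0 [/hermsymmxP Ah A0]; split=> [|u].
  by apply/hermsymmxP; rewrite linearZ map_mxZ Ah /= conj_Creal ?ger0_real.
by rewrite -scalemxAr -scalemxAl mxE mulr_ge0.
Qed.

Lemma psdmx_conj m n (K : 'M[C]_(n, m)) (A : 'M[C]_m) :
  psdmx A -> psdmx (K *m A *m K^t* ).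
Proof.
move=> /psdmx_factor[S ->].
by rewrite -mulmxA -mulmxA mulmxA -{1}(trmxCK K) -trmxC_mul; apply: psdmx_gram.
Qed.

(** Selecting the same rows and columns of [S^t* *m S] gives the Gram matrix of the selected columns
    of [S]. *)
Lemma psdmx_mxsub m n (f : 'I_n -> 'I_m) (A : 'M[C]_m) :
  psdmx A -> psdmx (mxsub f f A).
Proof.
move=> /psdmx_factor[S ->]; rewrite mxsub_mul.
suff -> : rowsub f (S^t* ) = (colsub f S)^t* by apply: psdmx_gram.
by apply/matrixP=> i j; rewrite !mxE.
Qed.

Lemma psdmx_tens m n (A : 'M[C]_m) (B : 'M[C]_n) :
  psdmx A -> psdmx B -> psdmx (A *t B).
Proof.
move=> /psdmx_factor[S ->] /psdmx_factor[T ->].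
by rewrite -tensmx_mul -trmxC_tens; apply: psdmx_gram.
Qed.

Lemma psdmx_diag_ge0 m (A : 'M[C]_m) i : psdmx A -> 0 <= A i i.
Proof.
move=> /psdmx_factor[S ->]; rewrite mxE sumr_ge0 // => j _.
by rewrite !mxE mulrC mul_conjC_ge0.
Qed.

Lemma psdmx_trace_ge0 m (A : 'M[C]_m) : psdmx A -> 0 <= \tr A.
Proof. by move=> A0; apply: sumr_ge0 => i _; apply: psdmx_diag_ge0. Qed.

Lemma psdmx_trace_mul_ge0 m (A B : 'M[C]_m) :
  psdmx A -> psdmx B -> 0 <= \tr (A *m B).
Proof.
move=> /psdmx_factor[S ->] B0.
by rewrite -mulmxA mxtrace_mulC psdmx_trace_ge0 //; apply: psdmx_conj.
Qed.

Lemma psdmx1 m : psdmx (1%:M : 'M[C]_m).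
Proof. by have := psdmx_gram (1%:M : 'M[C]_m); rewrite mulmx1 trmx1 map_mx1. Qed.

Lemma mxtrace_tens m n (A : 'M[C]_m) (B : 'M[C]_n) :
  \tr (A *t B) = \tr A * \tr B.
Proof. by rewrite /mxtrace mulr_sum; apply: eq_bigr => i _; rewrite mxE. Qed.

Lemma quantum_state_tens m n (A : 'M[C]_m) (B : 'M[C]_n) :
  quantum_state A -> quantum_state B -> quantum_state (A *t B).
Proof.
move=> [A0 tA] [B0 tB]; split; first exact: psdmx_tens.
by rewrite mxtrace_tens tA tB mulr1.
Qed.

Lemma quantum_state_ntens d n (rho : 'M[C]_d) :
  quantum_state rho -> quantum_state (ntensmx rho n).
Proof.
(* The zeroth power is the 1-by-1 identity; the induction for positive powers starts at the first
   power. *)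
move=> rhoS; case: n => [|n]; first by split; [exact: psdmx1|rewrite mxtrace1].
rewrite /ntensmx; elim: n => [|n IHn] //=; exact: quantum_state_tens.
Qed.

Lemma psdmx_sub_herm m (A B : 'M[C]_m) :
  psdmx A -> psdmx B -> A - B \is hermsymmx.
Proof.
move=> [/hermsymmxP Ah _] [/hermsymmxP Bh _].
by apply/hermsymmxP; rewrite linearB map_mxB Ah Bh.
Qed.

Lemma herm_spectralE m (H : 'M[C]_m) : H \is hermsymmx ->
  H = (spectralmx H)^t* *m diag_mx (spectral_diag H) *m spectralmx H.
Proof.
move=> /hermitian_normalmx/orthomx_spectralP {1}->.
by rewrite invmx_unitary // spectral_unitarymx.
Qed.

Lemma spectralmxKl m (A : 'M[C]_m) : (spectralmx A)^t* *m spectralmx A = 1%:M.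
Proof.
by rewrite -invmx_unitary ?spectral_unitarymx // mulVmx // spectral_unit.
Qed.

Lemma spectralmxKr m (A : 'M[C]_m) : spectralmx A *m (spectralmx A)^t* = 1%:M.
Proof. by apply/unitarymxP/spectral_unitarymx. Qed.

Lemma psdmx_diag m (s : 'rV[C]_m) : (forall i, 0 <= s 0 i) -> psdmx (diag_mx s).
Proof.
move=> s0.
have -> : diag_mx s = (diag_mx (map_mx sqrtC s))^t* *m diag_mx (map_mx sqrtC s).
  rewrite tr_diag_mx map_diag_mx mulmx_diag; congr diag_mx.
  apply/rowP=> i; rewrite !mxE /= conj_Creal ?ger0_real ?sqrtC_ge0 //.
  by rewrite -expr2 sqrtCK.
exact: psdmx_gram.
Qed.

Lemma char_poly_diag m (s : 'rV[C]_m) :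
  char_poly (diag_mx s) = \prod_(x <- [seq s 0 i | i <- enum 'I_m]) ('X - x%:P).
Proof.
rewrite char_poly_trig ?diag_mx_is_trig // big_map big_enum /=.
by apply: eq_bigr => i _; rewrite mxE eqxx.
Qed.

(** Both diagonals are root lists of one characteristic polynomial. This allows comparison of two
    diagonalizations whose eigenvalues come in unrelated orders. *)
Lemma diag_similar_perm m (P Q : 'M[C]_m) (s t : 'rV[C]_m) :
  P \in unitmx -> Q \in unitmx ->
  invmx P *m diag_mx s *m P = invmx Q *m diag_mx t *m Q ->
  perm_eq [seq s 0 i | i <- enum 'I_m] [seq t 0 i | i <- enum 'I_m].
Proof.
move=> Pu Qu E; apply: prod_XsubC_eq; rewrite -!char_poly_diag.
have sim (U : 'M[C]_m) v : U \in unitmx ->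
    char_poly (invmx U *m diag_mx v *m U) = char_poly (diag_mx v).
  move=> Uu; rewrite /char_poly /char_poly_mx !map_mxM.
  have UV : map_mx (@polyC C) (invmx U) *m map_mx polyC U = 1%:M.
    by rewrite -map_mxM mulVmx // map_mx1.
  rewrite -[X in \det (X - _)]mulmx1 -UV mulmxA -scalar_mxC -mulmxBl -mulmxBr.
  by rewrite !det_mulmx mulrAC -det_mulmx UV det1 mul1r.
by rewrite -(sim P) // E sim.
Qed.

End PsdTheory.

(** * Trace norm of Hermitian matrices, Jordan decomposition, Helstrom measurement *)

Section TraceNorm.
Local Open Scope sesquilinear_scope.
Local Open Scope complex_scope.
Variable R : realType.
Local Notation C := R[i].

Lemma spectral_diag_herm_real m (H : 'M[C]_m) i :
  H \is hermsymmx -> spectral_diag H 0 i \is Num.real.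
Proof. by move=> /hermitian_spectral_diag_real/mxOverP; apply. Qed.

(** A diagonalization of [H] also diagonalizes [H^t* *m H], with squared eigenvalues. [sqrtmx] uses
    another diagonalization of that product, so the eigenvalues agree up to a permutation, which the
    trace ignores. *)
Lemma trace_norm_herm m (H : 'M[C]_m) : H \is hermsymmx ->
  (trace_norm H)%:C = \sum_i `|spectral_diag H 0 i|.
Proof.
move=> Hh; set A := H^t* *m H; set s := spectral_diag H.
have /hermitian_normalmx/orthomx_spectralP AE : A \is hermsymmx.
  by have [] := psdmx_gram H.
have AE' : A =
    invmx (spectralmx H) *m diag_mx (\row_i (s 0 i ^+ 2)) *m spectralmx H.
  rewrite /A; move/hermsymmxP: (Hh) => ->; rewrite {1 2}(herm_spectralE Hh).
  rewrite (invmx_unitary (spectral_unitarymx H)) !mulmxA.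
  rewrite -[X in X *m _ *m _]mulmxA spectralmxKr mulmx1.
  rewrite -[X in X *m _]mulmxA mulmx_diag.
  congr (_ *m _ *m _).
have rs := diag_similar_perm (spectral_unit _) (spectral_unit _) (etrans (esym AE) AE').
have trE : \tr (sqrtmx A) = \sum_i `|s 0 i|.
  rewrite /sqrtmx mxtrace_mulC mulmxA mulmxV ?spectral_unit // mul1mx mxtrace_diag.
  transitivity (\sum_(x <- [seq spectral_diag A 0 i | i <- enum 'I_m]) sqrtC x).
    by rewrite big_map big_enum; apply: eq_bigr => i _; rewrite mxE.
  rewrite (perm_big _ rs) big_map big_enum; apply: eq_bigr => i _.
  by rewrite mxE -real_normK ?spectral_diag_herm_real // sqrCK.
by rewrite /trace_norm -/A trE RRe_real // ger0_real // sumr_ge0.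
Qed.

Lemma trace_norm_gt0 m (H : 'M[C]_m) :
  H \is hermsymmx -> H <> 0 -> 0 < trace_norm H.
Proof.
move=> Hh H0; rewrite -ltcR trace_norm_herm // lt_neqAle sumr_ge0 // andbT.
apply/negP => /eqP/esym/eqP; rewrite psumr_eq0 // => /allP s0; apply: H0.
rewrite (herm_spectralE Hh) (_ : spectral_diag H = 0) ?linear0 ?mulmx0 ?mul0mx //.
apply/rowP=> i; rewrite mxE; apply/eqP; rewrite -normr_eq0.
by apply: s0; rewrite mem_index_enum.
Qed.

(** In an eigenbasis of [P - N], each eigenvalue is a difference of nonnegative diagonal entries of
    [P] and [N], so its modulus is at most their sum. *)
Lemma trace_norm_psd_sub m (P N : 'M[C]_m) : psdmx P -> psdmx N ->
  (trace_norm (P - N))%:C <= \tr P + \tr N.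
Proof.
move=> P0 N0; have Hh := psdmx_sub_herm P0 N0.
rewrite trace_norm_herm //; set H := P - N in Hh *; set U := spectralmx H.
have dE i : spectral_diag H 0 i = (U *m P *m U^t* ) i i - (U *m N *m U^t* ) i i.
  transitivity ((U *m H *m U^t* ) i i).
    rewrite {2}(herm_spectralE Hh) !mulmxA spectralmxKr mul1mx.
    by rewrite -mulmxA spectralmxKr mulmx1 mxE eqxx mulr1n.
  by rewrite mulmxBr mulmxBl !mxE.
have trE (A : 'M[C]_m) : \tr A = \sum_i (U *m A *m U^t* ) i i.
  by rewrite -/(mxtrace _) mxtrace_mulC mulmxA spectralmxKl mul1mx.
rewrite (trE P) (trE N) -big_split /=; apply: ler_sum => i _.
rewrite dE (le_trans (ler_normB _ _)) // !ger0_norm //;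
  exact/psdmx_diag_ge0/psdmx_conj.
Qed.

Lemma herm_jordan m (H : 'M[C]_m) : H \is hermsymmx ->
  exists P N : 'M[C]_m, [/\ psdmx P, psdmx N, H = P - N &
    \tr P + \tr N = (trace_norm H)%:C].
Proof.
move=> Hh; set U := spectralmx H; set s := spectral_diag H.
have sR i : s 0 i \is Num.real by exact: spectral_diag_herm_real.
(* The sign [e = 1] gives the positive part of the spectrum, [e = -1] the negative part. *)
pose part (e : C) := U^t* *m diag_mx (\row_i ((`|s 0 i| + e * s 0 i) / 2)) *m U.
have part_psd e : e \in [:: 1; -1] -> psdmx (part e).
  move=> eE; rewrite /part -{2}(trmxCK U); apply: psdmx_conj.
  apply: psdmx_diag => i; rewrite mxE mulr_ge0 ?invr_ge0 ?ler0n //.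
  move: eE; rewrite !inE => /orP[]/eqP->; rewrite ?mul1r ?mulN1r.
    by rewrite -[X in _ + X]opprK subr_ge0 -normrN real_ler_norm ?realN.
  by rewrite subr_ge0 real_ler_norm.
have trE e : \tr (part e) = \sum_i ((`|s 0 i| + e * s 0 i) / 2).
  rewrite /part mxtrace_mulC mulmxA spectralmxKr mul1mx mxtrace_diag.
  by apply: eq_bigr => i _; rewrite mxE.
exists (part 1), (part (-1)); split.
- by apply: part_psd; rewrite !inE eqxx.
- by apply: part_psd; rewrite !inE eqxx orbT.
- rewrite {1}(herm_spectralE Hh) -mulmxBl -mulmxBr -linearB; congr (_ *m _ *m _).
  congr diag_mx; apply/rowP=> i; rewrite !mxE -/s.
  rewrite mul1r mulN1r -mulrBl opprD addrACA subrr add0r opprK -mulr2n.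
  by rewrite -[s 0 i *+ 2]mulr_natr mulfK ?pnatr_eq0.
- rewrite (trace_norm_herm Hh) (trE 1) (trE (-1)) -big_split /=.
  apply: eq_bigr => i _.
  rewrite -mulrDl mul1r mulN1r addrACA subrr addr0 -mulr2n.
  by rewrite -[_ *+ 2]mulr_natr mulfK ?pnatr_eq0.
Qed.

(* [M] is the projector onto the nonnegative eigenspaces of [H]. *)
Lemma helstrom m (H : 'M[C]_m) : H \is hermsymmx -> \tr H = 0 ->
  exists M : 'M[C]_m, [/\ psdmx M, psdmx (1%:M - M) &
    \tr (M *m H) = (trace_norm H / 2)%:C].
Proof.
move=> Hh trH; set U := spectralmx H; set s := spectral_diag H.
have sR i : s 0 i \is Num.real by exact: spectral_diag_herm_real.
pose e (b : bool) := U^t* *m diag_mx (\row_i ((0 <= s 0 i) == b)%:R) *m U.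
have e_psd b : psdmx (e b).
  rewrite /e -{2}(trmxCK U); apply: psdmx_conj.
  by apply: psdmx_diag => i; rewrite mxE ler0n.
exists (e true); split=> //.
- suff -> : 1%:M - e true = e false by [].
  apply/eqP; rewrite subr_eq -mulmxDl -mulmxDr -linearD -(spectralmxKl H); apply/eqP.
  rewrite -[X in X *m _ = _]mulmx1; do 2!congr (_ *m _).
  apply/matrixP=> i j; rewrite !mxE.
  by case: (0 <= _); rewrite ?add0r ?addr0.
(* Twice the nonnegative part of an eigenvalue is its modulus plus itself. The eigenvalues sum to
   zero, so only the moduli remain. *)
- have sum0 : \sum_i s 0 i = 0.
    move: trH; rewrite {1}(herm_spectralE Hh) mxtrace_mulC mulmxA spectralmxKr.
    by rewrite mul1mx mxtrace_diag.
  rewrite rmorphM fmorphV rmorph_nat /= trace_norm_herm // -/s.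
  rewrite {1}(herm_spectralE Hh) /e !mulmxA.
  rewrite -[X in \tr (X *m _ *m _)]mulmxA spectralmxKr mulmx1.
  rewrite mxtrace_mulC !mulmxA spectralmxKr mul1mx mulmx_diag mxtrace_diag.
  have two0 : 2 != 0 :> C by rewrite pnatr_eq0.
  apply: (mulIf two0).
  rewrite (divfK two0) -[RHS]addr0 -[X in _ + X]sum0 -big_split mulr_suml /=.
  apply: eq_bigr => i _; rewrite !mxE -/s /=.
  case: (real_ge0P (sR i)) => si; first by rewrite eqxx mul1r mulr_natr mulr2n.
  by rewrite !mul0r addNr.
Qed.

End TraceNorm.

(** * Complete positivity, Kraus operators, measure-and-prepare maps *)

Section CompletelyPositive.
Local Open Scope sesquilinear_scope.
Variable C : numClosedFieldType.

Lemma sum_mxtens (V : nmodType) m n (F : 'I_(m * n) -> V) :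
  \sum_x F x = \sum_i \sum_j F (mxtens_index (i, j)).
Proof.
rewrite pair_big; apply: (reindex (fun p => mxtens_index (p.1, p.2))) => /=.
exists (@mxtens_unindex m n) => [[i j] _|x _]; first exact: mxtens_indexK.
by case: (mxtens_indexP x) => i j; rewrite mxtens_indexK.
Qed.

Lemma tensblockP k p (X Y : 'M[C]_(k * p)) :
  (forall i j, tensblock X i j = tensblock Y i j) -> X = Y.
Proof.
move=> XY; apply/matrixP=> x y.
case: (mxtens_indexP x) => i a; case: (mxtens_indexP y) => j b.
by move/matrixP: (XY i j) => /(_ a b); rewrite !mxE.
Qed.

(** This blockwise description is the form in which [idtens] is used below. *)
Lemma tensblock_idtens k p q (f : 'M[C]_p -> 'M[C]_q) (X : 'M[C]_(k * p)) i j :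
  tensblock (idtens f X) i j = f (tensblock X i j).
Proof.
apply/matrixP=> a b; rewrite mxE /idtens summxE (bigD1 i) //= summxE.
rewrite (bigD1 j) //= tensmxE mxE !eqxx mul1r big1 ?addr0; last first.
  by move=> j' ne; rewrite tensmxE mxE [j == _]eq_sym (negPf ne) andbF mul0r.
rewrite big1 ?addr0 // => i' ne; rewrite summxE big1 // => j' _.
by rewrite tensmxE mxE eq_sym (negPf ne) mul0r.
Qed.

Lemma tensblock_sum k p I (r : seq I) (X : I -> 'M[C]_(k * p)) i j :
  tensblock (\sum_(l <- r) X l) i j = \sum_(l <- r) tensblock (X l) i j.
Proof.
by apply/matrixP=> a b; rewrite mxE !summxE; apply: eq_bigr => l _; rewrite mxE.
Qed.

Lemma tensblock_conj k p q (K : 'M[C]_(q, p)) (X : 'M[C]_(k * p)) i j :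
  tensblock ((1%:M *t K) *m X *m (1%:M *t K)^t* ) i j =
  K *m tensblock X i j *m K^t*.
Proof.
apply/matrixP=> a b; rewrite !mxE sum_mxtens (bigD1 j) //= [X in _ + X]big1.
  rewrite addr0; apply: eq_bigr => c _; congr (_ * _).
    rewrite !mxE sum_mxtens (bigD1 i) //= [X in _ + X]big1.
      by rewrite addr0; apply: eq_bigr => e _; rewrite tensmxE !mxE eqxx mul1r.
    move=> l ne; apply: big1 => e _.
    by rewrite tensmxE mxE eq_sym (negPf ne) !mul0r.
  by rewrite trmxC_tens tensmxE !mxE eqxx conjC1 mul1r.
move=> l ne; apply: big1 => c _.
by rewrite trmxC_tens tensmxE !mxE eq_sym eq_sym eq_sym (negPf ne) conjC0 mul0r mulr0.
Qed.

(** Compared block by block, the extension of [f] has Kraus operators [1%:M *t K l], and each of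
    them acts by a conjugation, which preserves positivity. *)
Lemma completely_positive_kraus p q (I : finType) (K : I -> 'M[C]_(q, p))
    (f : {linear 'M[C]_p -> 'M[C]_q}) :
  (forall X, f X = \sum_l K l *m X *m (K l)^t* ) -> completely_positive f.
Proof.
move=> fE k X X0.
have -> : idtens f X = \sum_l (1%:M *t K l) *m X *m (1%:M *t K l)^t*.
  apply: tensblockP => i j; rewrite tensblock_idtens fE tensblock_sum.
  by apply: eq_bigr => l _; rewrite tensblock_conj.
by apply: psdmx_sum => l _; apply: psdmx_conj.
Qed.

Lemma completely_positiveD p q (f g : {linear 'M[C]_p -> 'M[C]_q}) :
  completely_positive f -> completely_positive g ->
  completely_positive (f \+ g).
Proof.
move=> f0 g0 k X X0.
have -> : idtens (f \+ g) X = idtens f X + idtens g X.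
  apply: tensblockP => i j; rewrite tensblock_idtens /=.
  rewrite -(tensblock_idtens f) -(tensblock_idtens g).
  by apply/matrixP=> a b; rewrite !mxE.
by apply: psdmxD; [exact: f0|exact: g0].
Qed.

(** This is the case of a one-dimensional ancilla; [mxsub] identifies the indices of size [1 * q]
    with those of size [q]. *)
Lemma completely_positive_psd p q (f : {linear 'M[C]_p -> 'M[C]_q}) X :
  completely_positive f -> psdmx X -> psdmx (f X).
Proof.
move=> f0 X0; have XE : X = tensblock (1%:M *t X : 'M_(1 * p)) 0 0.
  by apply/matrixP=> a b; rewrite mxE tensmxE mxE mul1r.
have := f0 _ _ (psdmx_tens (psdmx1 C 1) X0).
pose g (a : 'I_q) := mxtens_index (0 : 'I_1, a).
move/(psdmx_mxsub g).
suff -> : mxsub g g (idtens f (1%:M *t X)) = f X by [].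
rewrite [RHS](congr1 f XE) -tensblock_idtens.
by apply/matrixP=> a b; rewrite !mxE.
Qed.

(** One branch of a measurement with effect [A]; a channel arises when the effects of the branches
    sum to the identity and the outputs have unit trace. *)
Definition measure_prepare p q (A : 'M[C]_p) (sigma : 'M[C]_q) (X : 'M[C]_p) :=
  \tr (A *m X) *: sigma.

Lemma measure_prepare_linear p q (A : 'M[C]_p) (sigma : 'M[C]_q) :
  linear (measure_prepare A sigma).
Proof.
move=> a X Y; rewrite /measure_prepare mulmxDr linearD -scalemxAr /=.
by rewrite mxtraceZ scalerDl scalerA.
Qed.

HB.instance Definition _ p q (A : 'M[C]_p) (sigma : 'M[C]_q) :=
  GRing.isLinear.Build C 'M[C]_p 'M[C]_q *:%R (measure_prepare A sigma)
    (measure_prepare_linear A sigma).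

Lemma completely_positive_measure_prepare p q (A : 'M[C]_p) (sigma : 'M[C]_q) :
  psdmx A -> psdmx sigma -> completely_positive (measure_prepare A sigma).
Proof.
move=> /psdmx_factor[T AE] /psdmx_factor[S sE].
(* In the Kraus sum, the second index yields the trace of [Y], which is [\tr (A *m X)], and the
   first resolves the identity between [S^t*] and [S]. *)
pose K (l : 'I_q * 'I_p) := S^t* *m delta_mx l.1 l.2 *m T.
apply: (completely_positive_kraus (K := K)) => X.
rewrite -[LHS]/(measure_prepare A sigma X) {}/K; set Y := T *m X *m T^t*.
have -> : measure_prepare A sigma X = \tr Y *: (S^t* *m S).
  by rewrite /measure_prepare AE -mulmxA mxtrace_mulC sE.
transitivity (\sum_e \sum_c (S^t* *m (Y c c *: delta_mx e e) *m S)).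
  rewrite -(eq_bigr _ (fun e _ => mulmx_suml _ _ _ _)).
  under eq_bigr do rewrite -mulmx_sumr -scaler_suml.
  rewrite -mulmx_suml -mulmx_sumr -scaler_sumr -mx1_sum_delta.
  by rewrite -scalemxAr mulmx1 -scalemxAl.
rewrite pair_big; apply: eq_bigr => -[e c] _ /=.
rewrite !trmxC_mul trmxCK trmx_delta map_delta_mx !mulmxA; congr (_ *m _).
rewrite -!mulmxA; congr (_ *m _).
rewrite !mulmxA -(mulmxA _ T) -(mulmxA _ (T *m X)) -/Y.
(* Splitting the matrix units through a one-dimensional index isolates the scalar [Y c c] in the
   middle. *)
rewrite -(mul_delta_mx (0 : 'I_1) e c) -(mul_delta_mx (0 : 'I_1) c e).
rewrite -(mulmxA (delta_mx e 0)) -(mulmxA (delta_mx e 0)) (mulmxA _ (delta_mx c 0)).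
rewrite -rowE -colE [col _ _]mx11_scalar !mxE.
by rewrite mul_scalar_mx -scalemxAr mul_delta_mx.
Qed.

Lemma cptp_discard_prepare p q (sigma : 'M[C]_q) :
  quantum_state sigma -> cptp (measure_prepare (1%:M : 'M_p) sigma).
Proof.
move=> [s0 s1]; split; first exact: completely_positive_measure_prepare (psdmx1 _ _) s0.
move=> X; rewrite -[LHS]/(\tr (measure_prepare 1%:M sigma X)).
by rewrite /measure_prepare mul1mx mxtraceZ s1 mulr1.
Qed.

Lemma cptp_measure_prepare2 p q (M : 'M[C]_p) (sigma1 sigma2 : 'M[C]_q) :
  psdmx M -> psdmx (1%:M - M) -> quantum_state sigma1 -> quantum_state sigma2 ->
  cptp (measure_prepare M sigma1 \+ measure_prepare (1%:M - M) sigma2).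
Proof.
move=> M0 M1 [s0 s1] [t0 t1]; split.
  by apply: completely_positiveD; apply: completely_positive_measure_prepare.
move=> X; rewrite -[LHS]/(\tr (measure_prepare M sigma1 X +
  measure_prepare (1%:M - M) sigma2 X)) /measure_prepare mxtraceD !mxtraceZ s1 t1 !mulr1.
by rewrite -mxtraceD -mulmxDl addrC subrK mul1mx.
Qed.

End CompletelyPositive.

(** * Lower and upper bounds on the cost of mapping two states to two targets *)

Section SimulationCost.
Local Open Scope complex_scope.
Local Open Scope sesquilinear_scope.
Variable R : realType.
Local Notation C := R[i].

(** Generalizes [cloning_costs] to arbitrary targets; cloning is the instance of tensor powers. *)
Definition simulation_costs p q (rho1 rho2 : 'M[C]_p) (tau1 tau2 : 'M[C]_q) :
    set R :=
  [set c | exists (lp lm : R) (Lp Lm : {linear 'M[C]_p -> 'M[C]_q}),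
    [/\ 0 <= lp /\ 0 <= lm, cptp Lp /\ cptp Lm,
        trace_preserving (quasi_map lp lm Lp Lm),
        quasi_map lp lm Lp Lm rho1 = tau1 /\ quasi_map lp lm Lp Lm rho2 = tau2
      & c = lp + lm]].

Lemma trace_preserving_quasi_map p q lp lm (Lp Lm : 'M[C]_p -> 'M[C]_q) :
  trace_preserving Lp -> trace_preserving Lm ->
  lp - lm = 1 -> trace_preserving (quasi_map lp lm Lp Lm).
Proof.
move=> LpT LmT lpm X; rewrite /quasi_map -scaleNr mxtraceD !mxtraceZ LpT LmT.
by rewrite -mulrDl -rmorphN -rmorphD /= lpm mul1r.
Qed.

Lemma simulation_cost_ge p q (rho1 rho2 : 'M[C]_p) (tau1 tau2 : 'M[C]_q) c :
  psdmx rho1 -> psdmx rho2 -> simulation_costs rho1 rho2 tau1 tau2 c ->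
  trace_norm (tau1 - tau2) <= c * trace_norm (rho1 - rho2).
Proof.
move=> r1 r2 [lp [lm [Lp [Lm [[lp0 lm0] [[Lp0 LpT] [Lm0 LmT]] _ [<- <-] ->]]]]].
have [P [N [P0 N0 PN trPN]]] := herm_jordan (psdmx_sub_herm r1 r2).
(* The negative weight exchanges [P] and [N], so the image of [P - N] is a difference of two values
   of [S], both positive. *)
pose S A B := lp%:C *: Lp A + lm%:C *: Lm B.
have S0 A B : psdmx A -> psdmx B -> psdmx (S A B).
  by move=> A0 B0; apply: psdmxD; apply: psdmxZ; rewrite ?ler0c //;
    apply: completely_positive_psd.
have -> : quasi_map lp lm Lp Lm rho1 - quasi_map lp lm Lp Lm rho2 =
    S P N - S N P.
  rewrite /quasi_map [in LHS]opprD addrACA -[X in _ + X]opprD -!scalerBr -!linearB.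
  by rewrite PN !linearB /= opprK [X in _ + X = _]addrC addrACA -opprD.
rewrite -lecR (le_trans (trace_norm_psd_sub (S0 _ _ P0 N0) (S0 _ _ N0 P0))) //.
rewrite rmorphM rmorphD /= -trPN /S !mxtraceD !mxtraceZ !LpT !LmT.
by rewrite le_eqVlt; apply/orP; left; apply/eqP; ring.
Qed.

Lemma simulation_cost_helstrom p q (rho1 rho2 : 'M[C]_p) (tau1 tau2 : 'M[C]_q) :
  quantum_state rho1 -> quantum_state rho2 -> rho1 <> rho2 ->
  quantum_state tau1 -> quantum_state tau2 ->
  simulation_costs rho1 rho2 tau1 tau2 (4 / trace_norm (rho1 - rho2) - 1).
Proof.
move=> [r1 tr1] [r2 tr2] r12 t1 t2.
have Hh := psdmx_sub_herm r1 r2.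
have N0 : 0 < trace_norm (rho1 - rho2).
  by apply: trace_norm_gt0 => // /subr0_eq.
set D2 := trace_norm _ in N0 *.
have trH : \tr (rho1 - rho2) = 0 by rewrite linearB /= tr1 tr2 subrr.
have [M [M0 M1 trM]] := helstrom Hh trH.
set D := D2 / 2; have D0 : 0 < D by rewrite divr_gt0.
(* The outcome probabilities are extracted as elements of [R], where linear arithmetic applies: [a],
   [a'] for [rho1] and [b], [b'] for [rho2]. *)
have E0 (A B : 'M[C]_p) : psdmx A -> psdmx B ->
    exists2 e : R, 0 <= e & \tr (A *m B) = e%:C.
  move=> A0 B0; have := psdmx_trace_mul_ge0 A0 B0.
  move=> ge0; have /complex_realP [e eE] := ger0_real ge0.
  by exists e; rewrite // -ler0c -eE.
have [a a0 aE] := E0 _ _ M0 r1; have [b b0 bE] := E0 _ _ M0 r2.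
have [a' a'0 a'E] := E0 _ _ M1 r1; have [b' b'0 b'E] := E0 _ _ M1 r2.
have aa' : a + a' = 1.
  apply: complexI; rewrite rmorphD /= -aE -a'E -mxtraceD -mulmxDl.
  by rewrite addrC subrK mul1mx tr1.
have bb' : b + b' = 1.
  apply: complexI; rewrite rmorphD /= -bE -b'E -mxtraceD -mulmxDl.
  by rewrite addrC subrK mul1mx tr2.
have abD : a - b = D.
  by apply: complexI; rewrite rmorphB /= -aE -bE -trM mulmxBr linearB.
(* The state prepared by the negative part: [tau1] and [tau2] mixed with the two error
   probabilities, of total weight [b + a' = 1 - D]. *)
have [tau tauS tauE] : exists2 tau : 'M[C]_q, quantum_state tau &
    (1 - D)%:C *: tau = b%:C *: tau1 + a'%:C *: tau2.
  (* For perfectly distinguishable states both error probabilities vanish, and any state can serve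
     as [tau]. *)
  have [D1|D1] := eqVneq D 1.
    exists tau1 => //; have -> : b = 0 by lra.
    have -> : a' = 0 by lra.
    by rewrite D1 subrr !scale0r addr0.
  have D1' : 0 < 1 - D by rewrite subr_gt0 lt_neqAle D1; lra.
  exists ((1 - D)^-1%:C *: (b%:C *: tau1 + a'%:C *: tau2)); last first.
    by rewrite scalerA -rmorphM /= mulfV ?scale1r // gt_eqF.
  case: t1 t2 => [t10 t11] [t20 t21]; split.
    apply: psdmxZ; first by rewrite ler0c invr_ge0 ltW.
    by apply: psdmxD; apply: psdmxZ; rewrite ?ler0c.
  rewrite mxtraceZ mxtraceD !mxtraceZ t11 t21 !mulr1 -rmorphD -rmorphM /=.
  have -> : b + a' = 1 - D by lra.
  by rewrite mulVf // gt_eqF.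
pose Lp : {linear 'M[C]_p -> 'M[C]_q} :=
  measure_prepare M tau1 \+ measure_prepare (1%:M - M) tau2.
pose Lm : {linear 'M[C]_p -> 'M[C]_q} := measure_prepare 1%:M tau.
have LpE X : Lp X = \tr (M *m X) *: tau1 + \tr ((1%:M - M) *m X) *: tau2 by [].
have LmE X : Lm X = \tr X *: tau.
  by rewrite -[LHS]/(measure_prepare 1%:M tau X) /measure_prepare mul1mx.
have LpC : cptp Lp by exact: cptp_measure_prepare2.
have LmC : cptp Lm by exact: cptp_discard_prepare.
clearbody Lp Lm; have lmE : D^-1 - 1 = D^-1 * (1 - D).
  by rewrite mulrBr mulr1 mulVf // gt_eqF.
(* Subtracting [tau] shifts the outcome probabilities by [b] and [a'], so the weights become 1 and 0
   at [rho1], and 0 and 1 at [rho2]. *)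
have quasiE X x x' : \tr X = 1 -> \tr (M *m X) = x%:C ->
    \tr ((1%:M - M) *m X) = x'%:C ->
    quasi_map D^-1 (D^-1 - 1) Lp Lm X =
    ((x - b) / D)%:C *: tau1 + ((x' - a') / D)%:C *: tau2.
  move=> X1 xE x'E; rewrite /quasi_map LpE LmE X1 xE x'E scale1r lmE.
  rewrite [in X in _ - X]rmorphM /= -[X in _ - X]scalerA tauE -scalerBr opprD addrACA.
  by rewrite -!scalerBl scalerDr !scalerA -!rmorphB -!rmorphM /= ![D^-1 * _]mulrC.
exists D^-1, (D^-1 - 1), Lp, Lm; split=> //.
- split; first by rewrite invr_ge0 ltW.
  by rewrite lmE mulr_ge0 ?invr_ge0 ?(ltW D0) //; lra.
- by apply: trace_preserving_quasi_map LpC.2 LmC.2 _; rewrite subKr.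
- split; [rewrite (quasiE _ a a') //|rewrite (quasiE _ b b') //].
    rewrite abD subrr mul0r scale0r addr0 mulfV ?scale1r // gt_eqF //.
  rewrite subrr mul0r scale0r add0r (_ : b' - a' = D); last lra.
  by rewrite mulfV ?scale1r // gt_eqF.
- by rewrite /D; field; rewrite gt_eqF.
Qed.

End SimulationCost.

(** * Continuous complex matrices and closed conditions on them *)

Section Continuity.
Local Open Scope classical_set_scope.
Local Open Scope sesquilinear_scope.
Local Open Scope complex_scope.
Variables (T : topologicalType) (R : realType).
Local Notation C := R[i].

(** Stated by components, so that only the topology of [R] is involved. *)
Definition complex_continuous (z : T -> C) :=
  continuous (fun t => complex.Re (z t)) /\ continuous (fun t => complex.Im (z t)).

Lemma complex_continuous_cst c : complex_continuous (fun=> c).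
Proof. by split=> t; exact: cvg_cst. Qed.

Lemma complex_continuousD z w : complex_continuous z -> complex_continuous w ->
  complex_continuous (fun t => z t + w t).
Proof.
move=> [zr zi] [wr wi]; split=> t.
  rewrite (_ : (fun t => _) = (fun t => complex.Re (z t) + complex.Re (w t))).
    by apply: cvgD; [exact: zr|exact: wr].
  by apply/funext => s; case: (z s) (w s) => [? ?] [].
rewrite (_ : (fun t => _) = (fun t => complex.Im (z t) + complex.Im (w t))).
  by apply: cvgD; [exact: zi|exact: wi].
by apply/funext => s; case: (z s) (w s) => [? ?] [].
Qed.

Lemma complex_continuousM z w : complex_continuous z -> complex_continuous w ->
  complex_continuous (fun t => z t * w t).
Proof.
move=> [zr zi] [wr wi]; split=> t.
  rewrite (_ : (fun t => _) = (fun t => complex.Re (z t) * complex.Re (w t) -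
    complex.Im (z t) * complex.Im (w t))).
    by apply: cvgB; apply: cvgM; [exact: zr|exact: wr|exact: zi|exact: wi].
  by apply/funext => s; case: (z s) (w s) => [? ?] [].
rewrite (_ : (fun t => _) = (fun t => complex.Re (z t) * complex.Im (w t) +
    complex.Im (z t) * complex.Re (w t))).
  by apply: cvgD; apply: cvgM; [exact: zr|exact: wi|exact: zi|exact: wr].
by apply/funext => s; case: (z s) (w s) => [? ?] [].
Qed.

Lemma complex_continuous_conj z :
  complex_continuous z -> complex_continuous (fun t => Num.conj (z t)).
Proof.
move=> [zr zi]; split=> t.
  rewrite (_ : (fun t => _) = (fun t => complex.Re (z t))); first exact: zr.
  by apply/funext => s; case: (z s).
rewrite (_ : (fun t => _) = (fun t => - complex.Im (z t))).
  by apply: cvgN; exact: zi.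
by apply/funext => s; case: (z s).
Qed.

Lemma complex_continuous_sum I (r : seq I) (z : I -> T -> C) :
  (forall i, complex_continuous (z i)) ->
  complex_continuous (fun t => \sum_(i <- r) z i t).
Proof.
move=> zc; elim: r => [|i r IHr].
  under eq_fun do rewrite big_nil; exact: complex_continuous_cst.
by under eq_fun do rewrite big_cons; apply: complex_continuousD.
Qed.

Lemma closed_continuous_ge0 (f : T -> R) :
  continuous f -> closed [set t | 0 <= f t].
Proof. by move=> fc; apply: (preimage_closed _ (@closed_ge _ 0)) => t _; exact: fc. Qed.

Lemma closed_continuous_eq0 (f : T -> R) :
  continuous f -> closed [set t | f t = 0].
Proof. by move=> fc; apply: (preimage_closed _ (@closed_eq _ 0)) => t _; exact: fc. Qed.

(** In the order of [R[i]] a nonnegative number is real, so the condition is one real equation and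
    one real inequality. *)
Lemma closed_complex_ge0 z : complex_continuous z -> closed [set t | 0 <= z t].
Proof.
move=> [zr zi].
rewrite (_ : mkset _ = [set t | complex.Im (z t) = 0] `&`
  [set t | 0 <= complex.Re (z t)]).
  by apply: closedI; [exact: closed_continuous_eq0|exact: closed_continuous_ge0].
apply/seteqP; split=> t /=; rewrite lecE /=; first by move/andP => [/eqP].
by move=> [-> ->]; rewrite eqxx.
Qed.

Lemma closed_complex_eq z w : complex_continuous z -> complex_continuous w ->
  closed [set t | z t = w t].
Proof.
move=> zc wc; have [dr di] : complex_continuous (fun t => z t + (-1) * w t).
  apply: complex_continuousD => //; apply: complex_continuousM => //.
  exact: complex_continuous_cst.
rewrite (_ : mkset _ = [set t | complex.Re (z t + (-1) * w t) = 0] `&`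
  [set t | complex.Im (z t + (-1) * w t) = 0]).
  by apply: closedI; exact: closed_continuous_eq0.
apply/seteqP; split=> t /=; rewrite mulN1r; first by move=> ->; rewrite subrr.
by move=> [r0 i0]; apply/eqP; rewrite -subr_eq0 eq_complex r0 i0 !eqxx.
Qed.

Lemma closed_forall I (P : I -> T -> Prop) :
  (forall i, closed [set t | P i t]) -> closed [set t | forall i, P i t].
Proof.
move=> Pc; rewrite (_ : mkset _ = \bigcap_i [set t | P i t]).
  exact: closed_bigI.
by apply/seteqP; split=> t Pt i; [move=> _; apply: Pt|apply: Pt].
Qed.

Definition matrix_continuous m n (A : T -> 'M[C]_(m, n)) :=
  forall i j, complex_continuous (fun t => A t i j).

Lemma matrix_continuous_cst m n (A : 'M[C]_(m, n)) :
  matrix_continuous (fun=> A).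
Proof. by move=> i j; exact: complex_continuous_cst. Qed.

Lemma matrix_continuousD m n (A B : T -> 'M[C]_(m, n)) :
  matrix_continuous A -> matrix_continuous B ->
  matrix_continuous (fun t => A t + B t).
Proof.
move=> Ac Bc i j; under eq_fun do rewrite mxE; exact: complex_continuousD.
Qed.

Lemma matrix_continuousZ m n z (A : T -> 'M[C]_(m, n)) :
  complex_continuous z -> matrix_continuous A ->
  matrix_continuous (fun t => z t *: A t).
Proof.
move=> zc Ac i j; under eq_fun do rewrite mxE; exact: complex_continuousM.
Qed.

Lemma matrix_continuousM m n p (A : T -> 'M[C]_(m, n)) (B : T -> 'M[C]_(n, p)) :
  matrix_continuous A -> matrix_continuous B ->
  matrix_continuous (fun t => A t *m B t).
Proof.
move=> Ac Bc i j; under eq_fun do rewrite mxE; apply: complex_continuous_sum => k.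
exact: complex_continuousM.
Qed.

Lemma closed_matrix_eq m n (A B : T -> 'M[C]_(m, n)) :
  matrix_continuous A -> matrix_continuous B -> closed [set t | A t = B t].
Proof.
move=> Ac Bc.
rewrite (_ : mkset _ = [set t | forall i j, A t i j = B t i j]).
  do 2!apply: closed_forall => ?; exact: closed_complex_eq.
by apply/seteqP; split=> t /= AB; [move=> i j; rewrite AB|apply/matrixP].
Qed.

Lemma closed_psdmx m (A : T -> 'M[C]_m) :
  matrix_continuous A -> closed [set t | psdmx (A t)].
Proof.
move=> Ac.
rewrite (_ : mkset _ = [set t | (A t)^t* = A t] `&`
  [set t | forall u : 'cV[C]_m, 0 <= (u^t* *m A t *m u) 0 0]).
  apply: closedI.
    apply: closed_matrix_eq => // i j; under eq_fun do rewrite !mxE.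
    exact: complex_continuous_conj.
  apply: closed_forall => u; apply: closed_complex_ge0.
  by do !apply: matrix_continuousM => //; exact: matrix_continuous_cst.
by apply/seteqP; split=> t /= -[/hermsymmxP].
Qed.

End Continuity.

(** * Linear maps as matrices, and entry bounds for channels *)

Section MatrixMap.
Local Open Scope sesquilinear_scope.
Variable C : numClosedFieldType.

(** Converse of [lin_mx]: it parametrizes maps by finitely many entries. *)
Definition mx_lin p q (A : 'M[C]_(p * p, q * q)) (X : 'M[C]_p) : 'M[C]_q :=
  vec_mx (mxvec X *m A).

Lemma mx_lin_linear p q (A : 'M[C]_(p * p, q * q)) : linear (mx_lin A).
Proof. by move=> a X Y; rewrite /mx_lin linearP mulmxDl -scalemxAl linearP. Qed.

HB.instance Definition _ p q (A : 'M[C]_(p * p, q * q)) :=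
  GRing.isLinear.Build C 'M[C]_p 'M[C]_q *:%R (mx_lin A) (mx_lin_linear A).

Lemma mx_linK p q (f : {linear 'M[C]_p -> 'M[C]_q}) : mx_lin (lin_mx f) =1 f.
Proof. by move=> X; rewrite /mx_lin mul_vec_lin mxvecK. Qed.

Lemma eq_cptp p q (f g : {linear 'M[C]_p -> 'M[C]_q}) :
  f =1 g -> cptp f -> cptp g.
Proof.
move=> fg [f0 fT]; split=> [k X X0|X]; last by rewrite -fg fT.
rewrite (_ : idtens g X = idtens f X); first exact: f0.
by apply: tensblockP => i j; rewrite !tensblock_idtens fg.
Qed.

(** Entries of a Gram matrix are inner products of columns; the arithmetic-geometric mean inequality
    is applied to each term. *)
Lemma psdmx_entry_le m (A : 'M[C]_m) i j :
  psdmx A -> `|A i j| <= (A i i + A j j) / 2.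
Proof.
move=> /psdmx_factor[S ->]; rewrite !mxE -big_split mulr_suml /=.
apply: le_trans (ler_norm_sum _ _ _) _; apply: ler_sum => k _.
rewrite !mxE normrM norm_conjC [X in (X + _) / _]mulrC [X in (_ + X) / _]mulrC.
by rewrite -!normCK (real_leif_mean_square _ _).1 // normr_real.
Qed.

(** The diagonal entries of each diagonal Choi block are nonnegative and sum to 1 by trace
    preservation; positivity then bounds the other entries. *)
Lemma cptp_entry_le1 p q (f : {linear 'M[C]_p -> 'M[C]_q}) k l :
  cptp f -> `|lin_mx f k l| <= 1.
Proof.
move=> [f0 fT].
(* [S^t* *m S] is the unnormalized maximally entangled state, so [Z] below is
   the Choi matrix of [f]. *)
pose S : 'rV[C]_(p * p) :=
  \row_x ((mxtens_unindex x).1 == (mxtens_unindex x).2)%:R.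
have blockE i j : tensblock (S^t* *m S) i j = delta_mx i j.
  apply/matrixP=> a b; rewrite !mxE big_ord1 !mxE !mxtens_indexK conjC_nat.
  by rewrite -natrM mulnb [i == _]eq_sym [j == _]eq_sym.
have Z0 := f0 _ _ (psdmx_gram S); set Z := idtens _ _ in Z0.
have ZE i j a b : Z (mxtens_index (i, a)) (mxtens_index (j, b)) =
    f (delta_mx i j) a b.
  by have := tensblock_idtens f (S^t* *m S) i j; rewrite blockE => <-; rewrite mxE.
have Zdiag x : Z x x <= 1.
  case: (mxtens_indexP x) => i a; rewrite ZE.
  have <- : \tr (f (delta_mx i i)) = 1.
    rewrite fT /mxtrace (bigD1 i) //= mxE !eqxx big1 ?addr0 // => j ne.
    by rewrite mxE (negPf ne).
  rewrite /mxtrace (bigD1 a) //= lerDl sumr_ge0 // => b _.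
  by rewrite -ZE psdmx_diag_ge0.
case/mxvec_indexP: k => i j; case/mxvec_indexP: l => a b.
rewrite /lin_mx mxE /= vec_mx_delta mxvecE -ZE.
apply: le_trans (psdmx_entry_le _ _ Z0) _.
by rewrite ler_pdivrMr ?ltr0n // mul1r -[2]/(1 + 1) lerD.
Qed.

End MatrixMap.

(** * Attainment of the minimal cost by compactness *)

Section OptimalSimulation.
Local Open Scope classical_set_scope.
Local Open Scope sesquilinear_scope.
Local Open Scope complex_scope.
Variables (R : realType) (p q : nat).
Local Notation C := R[i].

Lemma matrix_continuous_mx_lin (T : topologicalType)
    (A : T -> 'M[C]_(p * p, q * q)) (X : 'M[C]_p) :
  matrix_continuous A -> matrix_continuous (fun t => mx_lin (A t) X).
Proof.
move=> Ac i j; under eq_fun do rewrite /mx_lin mxE.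
exact: (matrix_continuousM (matrix_continuous_cst T (mxvec X)) Ac).
Qed.

Lemma closed_cptp_mx_lin (T : topologicalType)
    (A : T -> 'M[C]_(p * p, q * q)) :
  matrix_continuous A ->
  closed [set t | cptp (mx_lin (A t) : {linear _ -> _})].
Proof.
move=> Ac; rewrite (_ : mkset _ =
  [set t | completely_positive (mx_lin (A t) : {linear _ -> _})] `&`
  [set t | trace_preserving (mx_lin (A t))]); last first.
  by apply/seteqP; split=> t /= [].
apply: closedI.
  (* The intersection is indexed also by the proofs that [X] is positive. *)
  apply: closed_forall => k; apply: closed_forall => X; apply: closed_forall => X0.
  apply: closed_psdmx => x y.
  case: (mxtens_indexP x) => i a; case: (mxtens_indexP y) => j b.
  rewrite (_ : (fun t => _) = fun t => mx_lin (A t) (tensblock X i j) a b).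
    exact: matrix_continuous_mx_lin.
  by apply/funext => t; rewrite -tensblock_idtens mxE.
apply: closed_forall => X; apply: closed_complex_eq.
  apply: complex_continuous_sum => i; exact: matrix_continuous_mx_lin.
exact: complex_continuous_cst.
Qed.

Variables (rho1 rho2 : 'M[C]_p) (tau1 tau2 : 'M[C]_q).

(** The weight [lm] is replaced by [lp - 1], as trace preservation dictates, leaving [lp] as the
    only real weight. *)
Definition feasible (lp : R) (Ap Am : 'M[C]_(p * p, q * q)) : Prop :=
  [/\ 0 <= lp - 1, cptp (mx_lin Ap), cptp (mx_lin Am),
    quasi_map lp (lp - 1) (mx_lin Ap) (mx_lin Am) rho1 = tau1 &
    quasi_map lp (lp - 1) (mx_lin Ap) (mx_lin Am) rho2 = tau2].

Lemma closed_feasible (T : topologicalType) (lp : T -> R)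
    (Ap Am : T -> 'M[C]_(p * p, q * q)) :
  continuous lp -> matrix_continuous Ap -> matrix_continuous Am ->
  closed [set t | feasible (lp t) (Ap t) (Am t)].
Proof.
move=> lpc Apc Amc.
have lmc : continuous (fun t => lp t - 1).
  by move=> t; apply: cvgB; [exact: lpc|exact: cvg_cst].
have realc (f : T -> R) : continuous f -> complex_continuous (fun t => (f t)%:C).
  by move=> fc; split=> // t; exact: cvg_cst.
have quasic X : matrix_continuous (fun t =>
    quasi_map (lp t) (lp t - 1) (mx_lin (Ap t)) (mx_lin (Am t)) X).
  rewrite /quasi_map; under eq_fun do rewrite -scaleN1r.
  apply: matrix_continuousD.
    apply: matrix_continuousZ; first exact/realc.
    exact: matrix_continuous_mx_lin.
  apply: matrix_continuousZ; first exact: complex_continuous_cst.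
  by apply: matrix_continuousZ; [exact: realc|exact: matrix_continuous_mx_lin].
rewrite (_ : mkset _ = [set t | 0 <= lp t - 1] `&`
  ([set t | cptp (mx_lin (Ap t) : {linear _ -> _})] `&`
  ([set t | cptp (mx_lin (Am t) : {linear _ -> _})] `&`
  ([set t | quasi_map (lp t) (lp t - 1) (mx_lin (Ap t)) (mx_lin (Am t)) rho1
     = tau1] `&`
  [set t | quasi_map (lp t) (lp t - 1) (mx_lin (Ap t)) (mx_lin (Am t)) rho2
     = tau2])))); last first.
  by apply/seteqP; split=> t /= => [[? ? ? ? ?]|[? [? [? []]]]].
apply: closedI; first exact: closed_continuous_ge0.
apply: closedI; first exact: closed_cptp_mx_lin.
apply: closedI; first exact: closed_cptp_mx_lin.
by apply: closedI; apply: closed_matrix_eq => //; exact: matrix_continuous_cst.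
Qed.

(* A point of the parameter space lists [lp] (at [None]) and the real and
   imaginary parts of the entries of the matrices of [Lp] and [Lm]. *)
Let I : eqType := option (bool * bool * ('I_(p * p) * 'I_(q * q)))%type.
Let T : topologicalType := {ptws I -> R}.

Let coord (i : I) (t : T) : R := t i.

Let coord_continuous (i : I) : continuous (coord i).
Proof. exact: (@proj_continuous I (fun=> R)). Qed.

Let decode (b : bool) (t : T) : 'M[C]_(p * p, q * q) :=
  \matrix_(k, l) (coord (Some (b, true, (k, l))) t +i*
                  coord (Some (b, false, (k, l))) t)%C.

Let decode_continuous b : matrix_continuous (decode b).
Proof.
by move=> k l; split; under eq_fun do rewrite mxE; exact: coord_continuous.
Qed.

Let encode (lp : R) (Lp Lm : {linear 'M[C]_p -> 'M[C]_q}) : T := fun i =>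
  match i with
  | None => lp
  | Some (b, c, (k, l)) =>
      let z := lin_mx (if b then Lp else Lm) k l in
      if c then complex.Re z else complex.Im z
  end.

Let encodeK b lp Lp Lm :
  decode b (encode lp Lp Lm) = lin_mx (if b then Lp else Lm).
Proof.
by apply/matrixP=> k l; rewrite mxE /coord /encode; case: (lin_mx _ k l).
Qed.

Let feasible_at (t : T) : Prop :=
  feasible (coord None t) (decode true t) (decode false t).

(** The cost [lp + (lp - 1)] increases with [lp], so it suffices to minimize one coordinate; the
    known cost [c0] bounds the search. *)
Lemma simulation_cost_min c0 : \tr rho1 = 1 ->
  simulation_costs rho1 rho2 tau1 tau2 c0 ->
  exists eta, simulation_costs rho1 rho2 tau1 tau2 eta /\
    forall c, simulation_costs rho1 rho2 tau1 tau2 c -> eta <= c.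
Proof.
move=> tr1.
have costP c : simulation_costs rho1 rho2 tau1 tau2 c -> exists lp Lp Lm,
    [/\ feasible_at (encode lp Lp Lm), cptp Lp, cptp Lm & c = lp + (lp - 1)].
  move=> [lp [lm [Lp [Lm [[lp0 lm0] [LpC LmC] qT q12 ->]]]]].
  (* Trace preservation is evaluated at [rho1], which has unit trace. *)
  have lmE : lm = lp - 1.
    have := qT rho1; rewrite /quasi_map -scaleNr mxtraceD !mxtraceZ LpC.2 LmC.2.
    rewrite tr1 !mulr1 -rmorphN -rmorphD /= => /(@complexI R) <-; lra.
  exists lp, Lp, Lm; split=> //; last by rewrite lmE.
  have E b : mx_lin (decode b (encode lp Lp Lm)) = (if b then Lp else Lm).
    by apply/funext => X; rewrite encodeK mx_linK; case: b.
  case: q12 => q1 q2; split; rewrite ?E -?lmE //.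
  - by apply: eq_cptp LpC => X; rewrite -[RHS]/(mx_lin _ X) E.
  - by apply: eq_cptp LmC => X; rewrite -[RHS]/(mx_lin _ X) E.
have costI t : feasible_at t -> simulation_costs rho1 rho2 tau1 tau2
    (coord None t + (coord None t - 1)).
  move=> [lm0 LpC LmC q1 q2].
  pose L b : {linear 'M[C]_p -> 'M[C]_q} := mx_lin (decode b t).
  exists (coord None t), (coord None t - 1), (L true), (L false); split=> //.
    by split=> //; lra.
  by apply: trace_preserving_quasi_map LpC.2 LmC.2 _; rewrite subKr.
move=> /costP[b [Lp [Lm [feas LpC LmC c0E]]]].
have lp_ge1 t : feasible_at t -> 1 <= coord None t by move=> [lm0 _ _ _ _]; lra.
(* Real and imaginary parts inherit the bound 1 on channel entries; [b] is the weight [lp] of the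
   given solution. *)
pose box (i : I) : set R := if i is Some _ then `[-1, 1] else `[1, b].
pose S := [set t | feasible_at t] `&` [set t : T | forall i, box i (t i)].
have encS lp Mp Mm : feasible_at (encode lp Mp Mm) -> cptp Mp -> cptp Mm ->
    lp <= b -> S (encode lp Mp Mm).
  move=> fe MpC MmC lpb; split=> // -[[[s e] [k l]]|] /=; last first.
    by rewrite in_itv /= lpb andbT; exact: (lp_ge1 _ fe).
  have : `|lin_mx (if s then Mp else Mm) k l| <= 1.
    by case: s; apply: cptp_entry_le1.
  case: (lin_mx _ k l) => x y /= xy.
  have xy1 : x ^+ 2 + y ^+ 2 <= 1.
    by rewrite -lecR (add_Re2_Im2 (x +i* y)%C) expr_le1.
  have sqr_le1 (r s' : R) : r ^+ 2 + s' ^+ 2 <= 1 -> -1 <= r <= 1.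
    move=> rs; rewrite -ler_norml -(@expr_le1 _ 2) // real_normK ?num_real //.
    by have := sqr_ge0 s'; lra.
  rewrite in_itv /=; case: e; first exact: (sqr_le1 x y).
  by apply: (sqr_le1 y x); rewrite addrC.
have S0 : S !=set0 by exists (encode b Lp Lm); apply: encS.
have Sc : compact S.
  rewrite /S setIC; apply: compact_closedI; last exact: closed_feasible.
  by apply: (@tychonoff I (fun=> R)) => -[?|]; exact: segment_compact.
have [t /set_mem[tf tbox] tmin] := compact_EVT_min S0 Sc
  (continuous_subspaceT (@coord_continuous None)).
exists (coord None t + (coord None t - 1)); split; first exact: costI.
move=> c /costP[lp [Mp [Mm [fe MpC MmC ->]]]].
suff tlp : coord None t <= lp by rewrite lerD // lerB.
(* Solutions with weight above [b] lie outside the compact set, but the given solution of weight [b]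
   is already better. *)
have [lpb|/ltW blp] := leP lp b.
  by apply: (tmin (encode lp Mp Mm)); apply/mem_set/encS.
apply: le_trans blp; apply: (tmin (encode b Lp Lm)); exact/mem_set/encS.
Qed.

End OptimalSimulation.

(** * Specialization to cloning *)

Theorem theorem3 (R : realType) (d n : nat) (rho1 rho2 : 'M[R[i]]_d) :
  quantum_state rho1 -> quantum_state rho2 -> rho1 <> rho2 -> (1 <= n)%N ->
  exists eta : R, is_optimal_cloning_cost n rho1 rho2 eta /\
    trace_norm (ntensmx rho1 n - ntensmx rho2 n) / trace_norm (rho1 - rho2) <= eta /\
    eta <= 4 / trace_norm (rho1 - rho2) - 1.
Proof.
move=> r1 r2 r12 _.
have hel := simulation_cost_helstrom r1 r2 r12
  (quantum_state_ntens n r1) (quantum_state_ntens n r2).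
have [eta [etaC etaM]] := simulation_cost_min r1.2 hel.
exists eta; split; first by split.
split; last exact: etaM.
have N0 : 0 < trace_norm (rho1 - rho2).
  apply: trace_norm_gt0; last by move/subr0_eq.
  exact: psdmx_sub_herm r1.1 r2.1.
rewrite (ler_pdivrMr _ _ N0); exact: simulation_cost_ge r1.1 r2.1 etaC.
Qed.
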